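(* Let $Y$ be any topological space and let $H$ be an open subgroup of the free Markov topological group $F_M(Y)$. Then $H$ is isomorphic (as a topological group) to a free Markov topological group $F_M(Z)$ for some space $Z$ if and only if $H$ is disconnected.
   Context: The free Markov topological group $F_M(Y)$ on a space $Y$ is the topological group with continuous $\sigma:Y\to F_M(Y)$ such that every continuous map $Y\to G$ into a topological group factors uniquely as $\hat f\sigma$ for a continuous homomorphism $\hat f:F_M(Y)\to G$. No separation axioms are assumed on $Y$.
   Formalization: The space Z is required to be nonempty; with Z empty, F_M(Z) is the trivial group, so the trivial open subgroup of a discrete F_M(Y) would be free Markov yet connected, contradicting the claim as literally stated. *)

(* Defs.v *)
Record TopSpace := {
  pt :> Type;
  is_open : (pt -> Prop) -> Prop;
  open_full : is_open (fun _ => True);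
  open_inter : forall U V, is_open U -> is_open V -> is_open (fun x => U x /\ V x);
  open_union : forall F : (pt -> Prop) -> Prop,
      (forall U, F U -> is_open U) -> is_open (fun x => exists U, F U /\ U x)
}.
Arguments is_open {_} _.

Definition continuous {X Y : TopSpace} (f : X -> Y) : Prop :=
  forall V : Y -> Prop, is_open V -> is_open (fun x => V (f x)).

Definition prod_open {X Y : TopSpace} (W : X * Y -> Prop) : Prop :=
  forall p, W p -> exists (A : X -> Prop) (B : Y -> Prop),
    is_open A /\ is_open B /\ A (fst p) /\ B (snd p) /\
    (forall a b, A a -> B b -> W (a, b)).

Record TopGroup := {
  tg :> TopSpace;
  mul : tg -> tg -> tg;
  inv : tg -> tg;
  one : tg;
  mulA : forall x y z, mul x (mul y z) = mul (mul x y) z;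
  mul1g : forall x, mul one x = x;
  mulVg : forall x, mul (inv x) x = one;
  mul_cont : forall W : tg -> Prop, is_open W -> prod_open (fun p => W (mul (fst p) (snd p)));
  inv_cont : continuous inv
}.
Arguments mul {_} _ _.
Arguments inv {_} _.
Arguments one {_}.

Definition group_hom {G K : TopGroup} (f : G -> K) : Prop :=
  forall x y, f (mul x y) = mul (f x) (f y).

Definition is_free_Markov (Y : TopSpace) (G : TopGroup) (sigma : Y -> G) : Prop :=
  continuous sigma /\
  forall (K : TopGroup) (f : Y -> K), continuous f ->
    exists! fh : G -> K, group_hom fh /\ continuous fh /\ forall y, fh (sigma y) = f y.

Definition subgroup {G : TopGroup} (H : G -> Prop) : Prop :=
  H one /\ (forall x y, H x -> H y -> H (mul x y)) /\ (forall x, H x -> H (inv x)).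

Definition disconnected {X : TopSpace} (H : X -> Prop) : Prop :=
  exists U V : X -> Prop, is_open U /\ is_open V /\
    (exists x, H x /\ U x) /\ (exists x, H x /\ V x) /\
    (forall x, H x -> U x \/ V x) /\
    (forall x, H x -> U x -> V x -> False).

Definition topgroup_iso_onto {F G : TopGroup} (phi : F -> G) (H : G -> Prop) : Prop :=
  group_hom phi /\
  (forall x y, phi x = phi y -> x = y) /\
  (forall g, H g <-> exists x, phi x = g) /\
  continuous phi /\
  (forall U : F -> Prop, is_open U ->
     exists V : G -> Prop, is_open V /\
       forall g, (exists x, U x /\ phi x = g) <-> (H g /\ V g)).

(* Main.v *)
From Stdlib Require Import Classical ClassicalEpsilon FunctionalExtensionality PropExtensionality Arith Lia.
Require Import Defs.

(** Let [X = H\G] be the set of right cosets, which is discrete since [H] is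
    open, and let [r] be a Schreier transversal (its values are the paths of a
    spanning tree of the coset graph).  The Schreier generators
    [s (x, y) = r x * sigma y * (r (x . sigma y))^-1] form a continuous map
    [X * Y -> H], and [H] is free on it relative to [T = {e | s e = 1}]: homs
    [H -> K] correspond to homs from [G] to the topological group [K^X ><| G]
    lifting the identity of [G], and those are determined by their values on
    [Y].  If [H] is disconnected, some clopen proper subset [A] of [X * Y]
    contains [T]; fix [b0] outside [A] and put [c = s b0].  Then [H] is Markov
    free on the quotient of [X * Y] identifying [T] and [b0] to a point, with
    generators [s e * c] on [A] and [s e] off [A].  Conversely a free Markov
    group on a nonempty space maps onto the discrete group of order two. *)

(** * Local criteria for openness and continuity *)

Lemma open_ext {X : TopSpace} (U V : X -> Prop) :
  (forall x, U x <-> V x) -> is_open U -> is_open V.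
Proof.
  intros E HU. replace V with U; [exact HU|].
  extensionality x. apply propositional_extensionality, E.
Qed.

Lemma open_local {X : TopSpace} (U : X -> Prop) :
  (forall x, U x -> exists N, is_open N /\ N x /\ forall z, N z -> U z) -> is_open U.
Proof.
  intros L.
  apply (open_ext (fun x => exists N, (is_open N /\ forall z, N z -> U z) /\ N x)).
  - intros x; split.
    + intros (N & (_ & S) & Nx). auto.
    + intros Ux. destruct (L x Ux) as (N & ? & ? & ?). exists N; auto.
  - apply (open_union X (fun N => is_open N /\ forall z, N z -> U z)). tauto.
Qed.

Lemma open_const {X : TopSpace} (P : Prop) : is_open (fun _ : X => P).
Proof.
  apply open_local. intros x p. exists (fun _ => True).
  split; [apply open_full | tauto].
Qed.

Lemma continuous_comp {X Y Z : TopSpace} (f : X -> Y) (g : Y -> Z) :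
  continuous f -> continuous g -> continuous (fun x => g (f x)).
Proof. intros Hf Hg V HV. exact (Hf _ (Hg _ HV)). Qed.

Lemma continuous_clopen_cases {X Y : TopSpace} (A : X -> Prop) (f g h : X -> Y) :
  is_open A -> is_open (fun x => ~ A x) -> continuous f -> continuous g ->
  (forall x, A x -> h x = f x) -> (forall x, ~ A x -> h x = g x) -> continuous h.
Proof.
  intros HA HB Hf Hg Ef Eg V HV. apply open_local. intros x Vx.
  destruct (classic (A x)) as [a|a].
  - exists (fun z => A z /\ V (f z)).
    split; [apply open_inter; [exact HA | exact (Hf _ HV)]|].
    split; [rewrite <- Ef; auto|]. intros z [Az Vz]. rewrite Ef; auto.
  - exists (fun z => ~ A z /\ V (g z)).
    split; [apply (open_inter X (fun z => ~ A z)); [exact HB | exact (Hg _ HV)]|].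
    split; [rewrite <- Eg; auto|]. intros z [Az Vz]. rewrite Eg; auto.
Qed.

(** * Group laws and continuity of products *)

Section GroupLaws.
Context {G : TopGroup}.
Implicit Types x y z : G.

Lemma mul_left_inj x y z : mul x y = mul x z -> y = z.
Proof.
  intros E. rewrite <- (mul1g _ y), <- (mul1g _ z), <- (mulVg _ x), <- !mulA.
  now rewrite E.
Qed.

Lemma mulgV x : mul x (inv x) = one.
Proof.
  apply (mul_left_inj (inv x)). rewrite mulA, mulVg, mul1g.
  apply (mul_left_inj (inv (inv x))).
  now rewrite mulA, mulVg, mul1g.
Qed.

Lemma mulg1 x : mul x one = x.
Proof. now rewrite <- (mulVg _ x), mulA, mulgV, mul1g. Qed.

Lemma mulgK x y : mul (mul x y) (inv y) = x.
Proof. now rewrite <- mulA, mulgV, mulg1. Qed.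

Lemma mulgKV x y : mul (mul x (inv y)) y = x.
Proof. now rewrite <- mulA, mulVg, mulg1. Qed.

Lemma mul_right_inj x y z : mul y x = mul z x -> y = z.
Proof. intros E. rewrite <- (mulgK y x), E. apply mulgK. Qed.

Lemma inv_unique x y : mul x y = one -> x = inv y.
Proof. intros E. apply (mul_right_inj y). now rewrite mulVg. Qed.

Lemma invM x y : inv (mul x y) = mul (inv y) (inv x).
Proof. symmetry. apply inv_unique. now rewrite mulA, mulgKV, mulVg. Qed.

Lemma invK x : inv (inv x) = x.
Proof. symmetry. apply inv_unique, mulgV. Qed.

Lemma inv1 : inv one = one :> G.
Proof. symmetry. apply inv_unique, mul1g. Qed.

End GroupLaws.

Lemma hom_one {G K : TopGroup} (f : G -> K) : group_hom f -> f one = one.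
Proof.
  intros Hf. apply (mul_left_inj (f one)). now rewrite <- Hf, mul1g, mulg1.
Qed.

Lemma continuous_mul {X : TopSpace} {G : TopGroup} (f g : X -> G) :
  continuous f -> continuous g -> continuous (fun x => mul (f x) (g x)).
Proof.
  intros Hf Hg V HV. apply open_local. intros x Vx.
  destruct (mul_cont G V HV (f x, g x) Vx) as (A & B & HA & HB & Ax & Bx & S).
  exists (fun z => A (f z) /\ B (g z)).
  split; [exact (open_inter X _ _ (Hf _ HA) (Hg _ HB))|].
  split; [auto|]. intros z [Az Bz]. exact (S _ _ Az Bz).
Qed.

Lemma continuous_const {X Y : TopSpace} (c : Y) : continuous (fun _ : X => c).
Proof. intros V _. apply open_const. Qed.

Lemma continuous_id {X : TopSpace} : continuous (fun x : X => x).
Proof. intros V HV. exact HV. Qed.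

(** * Subspaces, subgroups as topological groups, the group of order two *)

Section Subspace.
Context {X : TopSpace} (P : X -> Prop).

Definition sub_open (U : {x | P x} -> Prop) : Prop :=
  exists V, is_open V /\ forall x, U x <-> V (proj1_sig x).

Definition subspace : TopSpace.
Proof.
  refine {| pt := {x | P x}; is_open := sub_open |}.
  - exists (fun _ => True). split; [apply open_full | tauto].
  - intros U V (U' & HU & EU) (V' & HV & EV).
    exists (fun x => U' x /\ V' x). split; [now apply open_inter|].
    intros x. now rewrite EU, EV.
  - intros F HF.
    (* All ambient open sets whose trace lies in [F] are united, so none has to be chosen for each
       member. *)
    exists (fun x => exists V, (is_open V /\ exists U, F U /\ forall z, U z <-> V (proj1_sig z)) /\ V x).
    split; [apply (open_union X (fun V => is_open V /\ exists U, F U /\ forall z, U z <-> V (proj1_sig z))); tauto|].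
    intros x; split.
    + intros (U & FU & Ux). destruct (HF U FU) as (V & HV & E).
      exists V. split; [eauto|]. now apply E.
    + intros (V & (HV & U & FU & E) & Vx). exists U. split; [exact FU|]. now apply E.
Defined.

Lemma continuous_val : continuous (fun x : subspace => proj1_sig x).
Proof. intros V HV. exists V. split; [exact HV | tauto]. Qed.

Lemma continuous_into_sub {Z : TopSpace} (f : Z -> subspace) :
  continuous (fun z => proj1_sig (f z)) -> continuous f.
Proof.
  intros Hf U (V & HV & E). apply (open_ext (fun z => V (proj1_sig (f z)))).
  - intros z. symmetry. apply E.
  - exact (Hf V HV).
Qed.

Lemma val_inj (x y : subspace) : proj1_sig x = proj1_sig y -> x = y.
Proof.
  destruct x as [x p], y as [y q]; simpl. intros <-. f_equal. apply proof_irrelevance.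
Qed.

End Subspace.

Definition subgroup_topgroup {G : TopGroup} (H : G -> Prop) (hH : subgroup H) : TopGroup.
Proof.
  unshelve refine {| tg := subspace H;
    mul := fun x y => exist _ (mul (proj1_sig x) (proj1_sig y))
             (proj1 (proj2 hH) _ _ (proj2_sig x) (proj2_sig y));
    inv := fun x => exist _ (inv (proj1_sig x)) (proj2 (proj2 hH) _ (proj2_sig x));
    one := exist _ one (proj1 hH) |}.
  - intros x y z. apply val_inj, mulA.
  - intros x. apply val_inj, mul1g.
  - intros x. apply val_inj, mulVg.
  - intros W (V & HV & E) [a b] Wp.
    apply E in Wp. destruct (mul_cont G V HV (proj1_sig a, proj1_sig b) Wp)
      as (A & B & HA & HB & Aa & Bb & S).
    exists (fun x => A (proj1_sig x)), (fun x => B (proj1_sig x)).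
    split; [exact (continuous_val H A HA)|].
    split; [exact (continuous_val H B HB)|].
    split; [exact Aa|]. split; [exact Bb|].
    intros x y Ax By. apply E. exact (S _ _ Ax By).
  - apply continuous_into_sub. simpl.
    exact (continuous_comp _ _ (continuous_val H) (inv_cont G)).
Defined.

Definition discrete (T : Type) : TopSpace.
Proof. refine {| pt := T; is_open := fun _ => True |}; trivial. Defined.

Definition Z2 : TopGroup.
Proof.
  refine {| tg := discrete bool; mul := xorb : discrete bool -> discrete bool -> discrete bool;
            inv := fun x => x; one := false |}.
  - intros x y z. now destruct x, y, z.
  - intros x. now destruct x.
  - intros x. now destruct x.
  - intros W _ [a b] Wp. exists (fun x => x = a), (fun x => x = b).
    repeat split. intros x y -> ->. exact Wp.
  - intros V _. exact I.
Defined.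

(** * Topologies generated by a subbase *)

Inductive generated_open {T : Type} (S : (T -> Prop) -> Prop) : (T -> Prop) -> Prop :=
| gen_base U : S U -> generated_open S U
| gen_full : generated_open S (fun _ => True)
| gen_inter U V : generated_open S U -> generated_open S V ->
    generated_open S (fun x => U x /\ V x)
| gen_union F : (forall U, F U -> generated_open S U) ->
    generated_open S (fun x => exists U, F U /\ U x).

Definition generated_space (T : Type) (S : (T -> Prop) -> Prop) : TopSpace :=
  {| pt := T; is_open := generated_open S; open_full := gen_full S;
     open_inter := gen_inter S; open_union := gen_union S |}.

Lemma continuous_generated {X : TopSpace} {T : Type} (S : (T -> Prop) -> Prop)
    (f : X -> generated_space T S) :
  (forall U, S U -> is_open (fun x => U (f x))) -> continuous f.
Proof.
  intros HS U HU. induction HU as [U SU | | U V _ IU _ IV | F _ IF].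
  - now apply HS.
  - apply open_full.
  - now apply open_inter.
  - apply open_local. intros x (U & FU & Ux). exists (fun z => U (f z)).
    split; [exact (IF U FU)|]. split; [exact Ux|]. intros z Uz. exists U. auto.
Qed.

(** Boxes around a point are stable under finite intersection, and a box for one member serves for
    the union, so joint continuity need only be tested on a subbase. *)
Lemma prod_open_generated {X X' : TopSpace} {T : Type} (S : (T -> Prop) -> Prop)
    (f : X * X' -> T) :
  (forall U, S U -> prod_open (fun p => U (f p))) ->
  forall U, generated_open S U -> prod_open (fun p => U (f p)).
Proof.
  intros HS U HU. induction HU as [U SU | | U V _ IU _ IV | F _ IF].
  - now apply HS.
  - intros p _. exists (fun _ => True), (fun _ => True).
    repeat split; apply open_full.
  - intros p [Up Vp].
    destruct (IU p Up) as (A & B & ? & ? & ? & ? & S1).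
    destruct (IV p Vp) as (A' & B' & ? & ? & ? & ? & S2).
    exists (fun x => A x /\ A' x), (fun x => B x /\ B' x).
    repeat split; try apply open_inter; auto; [apply S1 | apply S2]; tauto.
  - intros p (U & FU & Up). destruct (IF U FU p Up) as (A & B & ? & ? & ? & ? & S1).
    exists A, B. repeat split; auto. intros a b Aa Bb. exists U; auto.
Qed.

(** * Freeness relative to a set of trivial generators *)

(** Markov freeness is the case where [T] is empty, Graev freeness the case
    where [T] is a point. *)
Definition free_relative (E : TopSpace) (T : E -> Prop) (G : TopGroup) (s : E -> G) : Prop :=
  continuous s /\ (forall e, T e -> s e = one) /\
  forall (K : TopGroup) (f : E -> K), continuous f -> (forall e, T e -> f e = one) ->
    exists! fh : G -> K, group_hom fh /\ continuous fh /\ forall e, fh (s e) = f e.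

Lemma free_Markov_relative (Y : TopSpace) (G : TopGroup) (sigma : Y -> G) :
  is_free_Markov Y G sigma -> free_relative Y (fun _ => False) G sigma.
Proof. intros [C U]. split; [exact C|]. split; [tauto|]. intros; now apply U. Qed.

Lemma free_relative_hom_eq {E : TopSpace} {T : E -> Prop} {G : TopGroup} {s : E -> G}
    (hs : free_relative E T G s) (K : TopGroup) (f g : G -> K) :
  group_hom f -> continuous f -> group_hom g -> continuous g ->
  (forall e, f (s e) = g (s e)) -> f = g.
Proof.
  intros Hf Cf Hg Cg E'. destruct hs as (Cs & sT & U).
  destruct (U K (fun e => g (s e))) as (h & _ & Uh).
  - exact (continuous_comp _ _ Cs Cg).
  - intros e Te. rewrite (sT e Te). now apply hom_one.
  - transitivity h; [symmetry|]; apply Uh; auto.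
Qed.

(** The universal property maps [G] into [S] with its subspace topology. Followed by the inclusion,
    this map agrees with the identity on the generators, hence everywhere. *)
Lemma free_relative_generates {E : TopSpace} {T : E -> Prop} {G : TopGroup} {s : E -> G}
    (hs : free_relative E T G s) (S : G -> Prop) :
  subgroup S -> (forall e, S (s e)) -> forall g, S g.
Proof.
  intros hS Ss. pose proof hs as (Cs & sT & U).
  destruct (U (subgroup_topgroup S hS) (fun e => exist _ (s e) (Ss e)))
    as (h & (Hh & Ch & Eh) & _).
  - apply continuous_into_sub. exact Cs.
  - intros e Te. apply val_inj. exact (sT e Te).
  - assert (E' : (fun g => proj1_sig (h g)) = fun g => g).
    { apply (free_relative_hom_eq hs).
      - intros x y. now rewrite Hh.
      - exact (continuous_comp _ _ Ch (continuous_val S)).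
      - now intros x y.
      - apply continuous_id.
      - intros e. now rewrite Eh. }
    intros g. rewrite <- (equal_f E' g). exact (proj2_sig (h g)).
Qed.

(** * The semidirect product attached to an action *)

(** The semidirect product [K^X ><| G], [K^X] with the product topology. *)
Section Wreath.
Context {G : TopGroup} {X : Type} (act : X -> G -> X).
Hypothesis act1 : forall x, act x one = x.
Hypothesis actM : forall x g h, act x (mul g h) = act (act x g) h.
Hypothesis act_open : forall x x', is_open (fun g => act x g = x').
Variable K : TopGroup.

Inductive wreath_subbase : ((X -> K) * G -> Prop) -> Prop :=
| wreath_base_fun x V : is_open V -> wreath_subbase (fun w => V (fst w x))
| wreath_base_grp V : is_open V -> wreath_subbase (fun w => V (snd w)).

Definition wreath_space : TopSpace := generated_space ((X -> K) * G) wreath_subbase.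

Lemma continuous_wreath_fun x : continuous (fun w : wreath_space => fst w x).
Proof. intros V HV. apply gen_base. now constructor. Qed.

Lemma continuous_wreath_grp : continuous (fun w : wreath_space => snd w).
Proof. intros V HV. apply gen_base. now constructor. Qed.

Lemma continuous_into_wreath {Z : TopSpace} (f : Z -> wreath_space) :
  (forall x, continuous (fun z => fst (f z) x)) -> continuous (fun z => snd (f z)) ->
  continuous f.
Proof.
  intros H1 H2. apply continuous_generated. intros U [x V HV | V HV].
  - exact (H1 x V HV).
  - exact (H2 V HV).
Qed.

Lemma actK x g : act (act x g) (inv g) = x.
Proof. now rewrite <- actM, mulgV, act1. Qed.

Definition wreath_mul (w v : wreath_space) : wreath_space :=
  (fun x => mul (fst w x) (fst v (act x (snd w))), mul (snd w) (snd v)).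

Definition wreath_inv (w : wreath_space) : wreath_space :=
  (fun x => inv (fst w (act x (inv (snd w)))), inv (snd w)).

(** The coordinate being read moves with the group component, but [act_open] makes its index locally
    constant, so near each point a fixed coordinate is read. *)
Lemma wreath_inv_continuous : continuous wreath_inv.
Proof.
  apply continuous_into_wreath; simpl.
  - intros x V HV. apply open_local. intros w Vw.
    exists (fun v : wreath_space =>
      act x (inv (snd v)) = act x (inv (snd w)) /\ V (inv (fst v (act x (inv (snd w)))))).
    split; [|split; [split; auto|]].
    + apply open_inter.
      * exact (continuous_wreath_grp _ (inv_cont G _ (act_open x (act x (inv (snd w)))))).
      * exact (continuous_wreath_fun _ _ (inv_cont K _ HV)).
    + intros v [-> Vv]. exact Vv.
  - exact (continuous_comp _ _ continuous_wreath_grp (inv_cont G)).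
Qed.

Lemma wreath_mul_continuous (W : wreath_space -> Prop) :
  is_open W -> prod_open (fun p => W (wreath_mul (fst p) (snd p))).
Proof.
  apply (prod_open_generated wreath_subbase (fun p => wreath_mul (fst p) (snd p))).
  intros U [x V HV | V HV] [w v] Up; simpl in Up.
  - destruct (mul_cont K V HV (_, _) Up) as (A & B & HA & HB & Aw & Bv & S).
    (* The second condition freezes the index [act x (snd w')], so that [B] constrains a single
       coordinate of [v']. *)
    exists (fun w' : wreath_space => A (fst w' x) /\ act x (snd w') = act x (snd w)),
           (fun v' : wreath_space => B (fst v' (act x (snd w)))).
    split; [|split; [|split; [|split]]].
    + apply open_inter.
      * exact (continuous_wreath_fun _ _ HA).
      * exact (continuous_wreath_grp _ (act_open x (act x (snd w)))).
    + exact (continuous_wreath_fun _ _ HB).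
    + split; [exact Aw | reflexivity].
    + exact Bv.
    + intros w' v' [Aw' Ew'] Bv'. simpl. rewrite Ew'. exact (S _ _ Aw' Bv').
  - destruct (mul_cont G V HV (_, _) Up) as (A & B & HA & HB & Aw & Bv & S).
    exists (fun w' : wreath_space => A (snd w')), (fun v' : wreath_space => B (snd v')).
    split; [exact (continuous_wreath_grp _ HA)|].
    split; [exact (continuous_wreath_grp _ HB)|].
    split; [exact Aw|]. split; [exact Bv|].
    intros w' v' Aw' Bv'. exact (S _ _ Aw' Bv').
Qed.

Definition wreath : TopGroup.
Proof.
  refine {| tg := wreath_space; mul := wreath_mul; inv := wreath_inv;
            one := ((fun _ => one, one) : wreath_space);
            mul_cont := wreath_mul_continuous; inv_cont := wreath_inv_continuous |}.
  - intros w v u. unfold wreath_mul. apply f_equal2; simpl.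
    + extensionality x. now rewrite mulA, actM.
    + apply mulA.
  - intros [a g]. unfold wreath_mul. simpl. apply f_equal2.
    + extensionality x. now rewrite mul1g, act1.
    + apply mul1g.
  - intros [a g]. unfold wreath_mul, wreath_inv. simpl. apply f_equal2.
    + extensionality x. now rewrite mulVg.
    + apply mulVg.
Defined.

End Wreath.

(** * Schreier transversals from shortest paths *)

Section SchreierTransversal.
Context {G : TopGroup} {Y X : Type} (sigma : Y -> G) (act : X -> G -> X) (x0 : X).
Hypothesis act1 : forall x, act x one = x.
Hypothesis actM : forall x g h, act x (mul g h) = act (act x g) h.
Hypothesis trans : forall x, exists g, act x0 g = x.
Hypothesis gens : forall S : G -> Prop, subgroup S -> (forall y, S (sigma y)) -> forall g, S g.

Definition letter (g : G) : Prop := exists y, g = sigma y \/ g = inv (sigma y).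

Fixpoint reach (n : nat) (x : X) : Prop :=
  match n with
  | 0 => x = x0
  | S n => exists x' g, reach n x' /\ letter g /\ x = act x' g
  end.

Definition connected_by (g : G) : Prop :=
  forall x n, reach n x -> exists m, reach m (act x g).

(** Pairing [g] with its inverse makes the property define a subgroup, so [gens] reduces it to
    single letters. *)
Lemma connected_all g : connected_by g /\ connected_by (inv g).
Proof.
  apply (gens (fun g => connected_by g /\ connected_by (inv g))).
  - split; [|split].
    + rewrite inv1. split; intros x n Rx; exists n; now rewrite act1.
    + assert (C : forall a b, connected_by a -> connected_by b -> connected_by (mul a b)).
      { intros a b Ca Cb x n Rx. destruct (Ca x n Rx) as [m Rm].
        rewrite actM. exact (Cb _ m Rm). }
      intros a b [? ?] [? ?]. rewrite invM. auto.
    + intros a [? ?]. rewrite invK. auto.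
  - intros y. split; intros x n Rx; exists (S n), x; eexists;
      (split; [exact Rx|]; split; [|reflexivity]); exists y; auto.
Qed.

Lemma min_reach x : exists n, reach n x /\ forall m, m < n -> ~ reach m x.
Proof.
  destruct (trans x) as [g <-].
  destruct (proj1 (connected_all g) x0 0 eq_refl) as [n Rn].
  revert Rn. induction n as [n IH] using lt_wf_ind. intros Rn.
  destruct (classic (exists m, m < n /\ reach m (act x0 g))) as [(m & L & R)|N].
  - exact (IH m L R).
  - exists n. split; [exact Rn|]. intros m L R. eauto.
Qed.

(** The induction principle goes along the edges of a spanning tree: the edge
    [(x, y)] is among those satisfying [r (x . sigma y) = r x * sigma y]. *)
Lemma schreier_transversal :
  exists r : X -> G, r x0 = one /\ (forall x, act x0 (r x) = x) /\
    forall Q : X -> Prop, Q x0 ->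
      (forall x y, r (act x (sigma y)) = mul (r x) (sigma y) ->
                   Q x <-> Q (act x (sigma y))) ->
      forall x, Q x.
Proof.
  destruct (choice _ min_reach) as [d Hd].
  assert (d0 : forall x, d x = 0 -> x = x0).
  { intros x E. destruct (Hd x) as [R _]. now rewrite E in R. }
  (* [q x] is the parent of [x] in the spanning tree together with the letter on the edge; at the
     root [x0] its value is a dummy. *)
  assert (par : forall x, exists q : X * G, x <> x0 ->
      d x = S (d (fst q)) /\ letter (snd q) /\ x = act (fst q) (snd q)).
  { intros x. destruct (classic (x = x0)) as [E|N]; [now exists (x, one)|].
    destruct (Hd x) as [R M]. destruct (d x) as [|n] eqn:Edx; [now elim N|].
    destruct R as (x' & g & R' & L & E). exists (x', g). intros _. simpl.
    split; [|auto]. destruct (Hd x') as [R1 M1].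
    destruct (lt_eq_lt_dec n (d x')) as [[C|C]|C].
    (* The parent lies at depth exactly [n]: a greater depth contradicts its own minimality, a
       smaller one that of [x]. *)
    - now elim (M1 n C).
    - now rewrite C.
    - exfalso. apply (M (S (d x'))); [lia|]. exists x', g. auto. }
  destruct (choice _ par) as [q Hq].
  (* [R] multiplies the letters along the path to the root; its recursion runs on the depth, since
     the parent map is not structurally decreasing. *)
  pose (R := fix R n x := match n with
                          | 0 => one
                          | S n => mul (R n (fst (q x))) (snd (q x))
                          end : G).
  assert (d00 : d x0 = 0).
  { destruct (d x0) eqn:E; [reflexivity|].
    elim (proj2 (Hd x0) 0); [lia | reflexivity]. }
  pose (r := fun x => R (d x) x).
  assert (rS : forall x, x <> x0 -> r x = mul (r (fst (q x))) (snd (q x))).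
  { intros x N. unfold r. now rewrite (proj1 (Hq x N)). }
  assert (ind : forall Q : X -> Prop, Q x0 ->
      (forall x, x <> x0 -> Q (fst (q x)) -> Q x) -> forall x, Q x).
  { intros Q Q0 QS x. remember (d x) as n eqn:E. revert x E.
    induction n as [|n IH]; intros x E.
    - now rewrite (d0 x).
    - assert (N : x <> x0) by (intros ->; congruence).
      apply (QS x N), IH. destruct (Hq x N). congruence. }
  exists r. split; [unfold r; now rewrite d00|]. split.
  - apply ind.
    + unfold r. rewrite d00. apply act1.
    + intros x N I. rewrite rS by exact N. rewrite actM, I.
      symmetry. apply (Hq x N).
  - intros Q Q0 QS. apply ind; [exact Q0|]. intros x N I.
    destruct (Hq x N) as (_ & (y & [L|L]) & E); specialize (rS x N);
      rewrite L in E, rS.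
    + rewrite E. apply QS; [|exact I]. now rewrite <- E.
    (* For an inverse letter the positive edge runs from [x] to its parent, so the equivalence for
       [Q] is used from right to left. *)
    + assert (E' : act x (sigma y) = fst (q x)).
      { rewrite E at 1. now rewrite <- actM, mulVg, act1. }
      apply (QS x y); rewrite E'; [|exact I]. now rewrite rS, mulgKV.
Qed.

End SchreierTransversal.

(** * Schreier generators and relative freeness of open subgroups *)

(** The product of the discrete space [X] with [Y]. *)
Definition sheets (X : Type) (Y : TopSpace) : TopSpace.
Proof.
  refine {| pt := (X * Y)%type; is_open := fun U => forall x, is_open (fun y => U (x, y)) |}.
  - intros x. apply open_full.
  - intros U V HU HV x. now apply open_inter.
  - intros F HF x. apply open_local. intros y (U & FU & Uy).
    exists (fun y => U (x, y)). split; [exact (HF U FU x)|]. split; [exact Uy|]. intros z Uz. exists U. auto.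
Defined.

Section SchreierGenerators.
Context {Y : TopSpace} {G : TopGroup} {sigma : Y -> G} (hG : is_free_Markov Y G sigma).
Context {H : G -> Prop} (hH : subgroup H).
Context {X : Type} (act : X -> G -> X) (x0 : X).
Hypothesis act1 : forall x, act x one = x.
Hypothesis actM : forall x g h, act x (mul g h) = act (act x g) h.
Hypothesis act_open : forall x x', is_open (fun g => act x g = x').
Hypothesis stab : forall g, H g <-> act x0 g = x0.
Variable r : X -> G.
Hypothesis r0 : r x0 = one.
Hypothesis actr : forall x, act x0 (r x) = x.
Hypothesis r_ind : forall Q : X -> Prop, Q x0 ->
      (forall x y, r (act x (sigma y)) = mul (r x) (sigma y) ->
                   Q x <-> Q (act x (sigma y))) ->
      forall x, Q x.

Let HG : TopGroup := subgroup_topgroup H hH.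

Definition defect (x : X) (g : G) : G := mul (mul (r x) g) (inv (r (act x g))).

Lemma defect_in x g : H (defect x g).
Proof.
  apply stab. unfold defect. rewrite 2!actM, actr.
  rewrite <- (actr (act x g)) at 1. apply actK; auto.
Qed.

Definition defectH (x : X) (g : G) : HG := exist _ (defect x g) (defect_in x g).

(** The factor [r (act x g)] is locally constant in [g], so locally [defect x] is a two-sided
    translation. *)
Lemma defectH_continuous x : continuous (defectH x).
Proof.
  apply continuous_into_sub. simpl. intros V HV. apply open_local. intros g Vg.
  exists (fun h => act x h = act x g /\ V (mul (mul (r x) h) (inv (r (act x g))))).
  split; [|split; [auto|]].
  - apply open_inter; [apply act_open|].
    apply (continuous_mul (fun h => mul (r x) h) (fun _ => inv (r (act x g)))); auto.
    + apply continuous_mul; [apply continuous_const | apply continuous_id].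
    + apply continuous_const.
  - intros h [E Vh]. unfold defect. now rewrite E.
Qed.

(** The cocycle identity, by cancellation of [r (act x g)]; it makes [induced] multiplicative in the
    semidirect product. *)
Lemma defectH_mul x g h : defectH x (mul g h) = mul (defectH x g) (defectH (act x g) h).
Proof.
  apply val_inj. simpl. unfold defect.
  now rewrite !mulA, mulgKV, actM.
Qed.

Lemma defectH_base (u : HG) : defectH x0 (proj1_sig u) = u.
Proof.
  apply val_inj. simpl. unfold defect.
  now rewrite (proj1 (stab _) (proj2_sig u)), r0, inv1, mulg1, mul1g.
Qed.

Definition schreier_gen (e : sheets X Y) : HG := defectH (fst e) (sigma (snd e)).

Let Wr (K : TopGroup) : TopGroup := wreath act act1 actM act_open K.

Definition induced {K : TopGroup} (h : HG -> K) (g : G) : Wr K :=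
  (fun x => h (defectH x g), g).

Lemma induced_hom {K : TopGroup} (h : HG -> K) : group_hom h -> group_hom (induced h).
Proof.
  intros Hh a b. apply injective_projections; [|reflexivity].
  extensionality x. simpl. now rewrite defectH_mul, Hh.
Qed.

Lemma induced_continuous {K : TopGroup} (h : HG -> K) :
  continuous h -> continuous (induced h).
Proof.
  intros Ch. apply (continuous_into_wreath K); simpl.
  - intros x. exact (continuous_comp _ _ (defectH_continuous x) Ch).
  - apply continuous_id.
Qed.

(** Both induced homs on [G] have the same values on [sigma], so they coincide; the coordinate at
    [x0] recovers [h] from [induced h]. *)
Lemma schreier_hom_unique (K : TopGroup) (h h' : HG -> K) :
  group_hom h -> continuous h -> group_hom h' -> continuous h' ->
  (forall e, h (schreier_gen e) = h' (schreier_gen e)) -> h = h'.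
Proof.
  intros Hh Ch Hh' Ch' E.
  assert (E' : induced h = induced h').
  { apply (free_relative_hom_eq (free_Markov_relative _ _ _ hG));
      auto using induced_hom, induced_continuous.
    intros y. unfold induced. apply f_equal2; [|reflexivity].
    extensionality x. exact (E (x, y)). }
  extensionality u. rewrite <- (defectH_base u).
  exact (equal_f (f_equal fst (equal_f E' (proj1_sig u))) x0).
Qed.

(** The map [f] prescribes a hom [Phi] from [G] to the semidirect product. Its coordinate at [x0] is
    a crossed hom, which becomes a hom on [H] because [H] fixes [x0]. *)
Lemma schreier_hom_exists (K : TopGroup) (f : sheets X Y -> K) :
  continuous f -> (forall e, schreier_gen e = one -> f e = one) ->
  exists h : HG -> K, group_hom h /\ continuous h /\ forall e, h (schreier_gen e) = f e.
Proof.
  intros Cf fT.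
  destruct (proj2 hG (Wr K) (fun y => (fun x => f (x, y), sigma y)))
    as (Phi & (HPhi & CPhi & EPhi) & _).
  { apply (continuous_into_wreath K); simpl.
    - intros x V HV. exact (Cf V HV x).
    - exact (proj1 hG). }
  assert (Eid : (fun g => snd (Phi g)) = fun g => g).
  { apply (free_relative_hom_eq (free_Markov_relative _ _ _ hG)).
    - intros a b. now rewrite HPhi.
    - exact (continuous_comp _ _ CPhi (continuous_wreath_grp K)).
    - now intros a b.
    - apply continuous_id.
    - intros y. now rewrite EPhi. }
  pose (P := fun g x => fst (Phi g) x).
  assert (PM : forall a b x, P (mul a b) x = mul (P a x) (P b (act x a))).
  { intros a b x. unfold P. rewrite HPhi. simpl. now rewrite (equal_f Eid a). }
  assert (Ps : forall x y, P (sigma y) x = f (x, y)).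
  { intros x y. unfold P. now rewrite EPhi. }
  assert (P1 : P one x0 = one).
  { unfold P. now rewrite (hom_one _ HPhi). }
  (* Along a tree edge the Schreier generator is trivial, hence so is [f], and the value propagates
     from the root. *)
  assert (Pr : forall x, P (r x) x0 = one).
  { apply r_ind; [now rewrite r0|]. intros x y E.
    rewrite E, PM, actr, Ps, fT, mulg1; [tauto|].
    apply val_inj. simpl. unfold defect. rewrite E. apply mulgV. }
  exists (fun u => P (proj1_sig u) x0). split; [|split].
  - intros u v. simpl. rewrite PM. now rewrite (proj1 (stab _) (proj2_sig u)).
  - exact (continuous_comp _ _ (continuous_comp _ _ (continuous_val H) CPhi)
             (continuous_wreath_fun K x0)).
  - intros [x y]. simpl.
    (* Appending the trivial value at [r (act x (sigma y))] cancels the inverse in [defect], leaving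
       [r x * sigma y]. *)
    rewrite <- (mulg1 (P _ _)), <- (Pr (act x (sigma y))).
    rewrite <- (proj1 (stab _) (defect_in x (sigma y))) at 2.
    rewrite <- PM. unfold defect. rewrite mulgKV, PM, Pr, actr, mul1g. apply Ps.
Qed.

Lemma schreier_free_relative :
  free_relative (sheets X Y) (fun e => schreier_gen e = one) HG schreier_gen.
Proof.
  split; [|split; [auto|]].
  - intros V HV x. exact (proj1 hG _ (defectH_continuous x V HV)).
  - intros K f Cf fT. destruct (schreier_hom_exists K f Cf fT) as (h & Hh & Ch & Eh).
    exists h. split; [auto|]. intros h' (Hh' & Ch' & Eh').
    apply schreier_hom_unique; auto. intros e. now rewrite Eh, Eh'.
Qed.

End SchreierGenerators.

Lemma open_subgroup_free_relative (Y : TopSpace) (G : TopGroup) (sigma : Y -> G)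
    (hG : is_free_Markov Y G sigma) (H : G -> Prop) (hH : subgroup H) (hHo : is_open H) :
  exists (E : TopSpace) (T : E -> Prop) (s : E -> subgroup_topgroup H hH),
    free_relative E T (subgroup_topgroup H hH) s.
Proof.
  (* The right coset [H g] is encoded as the predicate [tr H g]. *)
  pose (tr := fun (C : G -> Prop) (g : G) => fun k => C (mul k (inv g))).
  assert (tr1 : forall C, tr C one = C).
  { intros C. extensionality k. unfold tr. now rewrite inv1, mulg1. }
  assert (trM : forall C g h, tr C (mul g h) = tr (tr C g) h).
  { intros C g h. extensionality k. unfold tr. now rewrite invM, mulA. }
  pose (X := {C : G -> Prop | exists g, C = tr H g}).
  assert (X_eq : forall x x' : X, proj1_sig x = proj1_sig x' -> x = x').
  { intros [C p] [C' p']. simpl. intros <-. f_equal. apply proof_irrelevance. }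
  assert (trX : forall (x : X) g, exists k, tr (proj1_sig x) g = tr H k).
  { intros [C [k ->]] g. exists (mul k g). symmetry. apply trM. }
  pose (act := fun (x : X) g => exist _ (tr (proj1_sig x) g) (trX x g) : X).
  pose (x0 := exist _ H (ex_intro _ one (eq_sym (tr1 H))) : X).
  assert (act1 : forall x, act x one = x) by (intros x; apply X_eq, tr1).
  assert (actM : forall x g h, act x (mul g h) = act (act x g) h)
    by (intros x g h; apply X_eq, trM).
  pose proof hH as (H1 & HM & HV).
  assert (stab : forall g, H g <-> act x0 g = x0).
  { intros g. split.
    - intros Hg. apply X_eq. simpl. extensionality k.
      apply propositional_extensionality. unfold tr. split; intros Hk.
      + rewrite <- (mulgKV k g). auto.
      + auto.
    - intros E. apply (f_equal (@proj1_sig _ _)) in E. simpl in E.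
      rewrite <- (invK g). apply HV. rewrite <- (mul1g _ (inv g)).
      change (tr H g one). now rewrite E. }
  assert (trans : forall x, exists g, act x0 g = x).
  { intros [C [g Eg]]. exists g. apply X_eq. simpl. auto. }
  (* With [x = x0 . a] and [x' = x0 . b] this set is [a^-1 H b], which is open because [H] is. *)
  assert (act_open : forall x x', is_open (fun g => act x g = x')).
  { intros x x'. destruct (trans x) as [a <-], (trans x') as [b <-].
    apply (open_ext (fun g => H (mul (mul a g) (inv b)))).
    - intros g. rewrite stab, 2!actM. split; intros E.
      + rewrite <- E at 2. now rewrite <- (actM _ (inv b)), mulVg, act1.
      + rewrite E. now rewrite <- actM, mulgV, act1.
    - apply (continuous_mul (fun g => mul a g) (fun _ => inv b)); auto.
      + apply continuous_mul; [apply continuous_const | apply continuous_id].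
      + apply continuous_const. }
  destruct (schreier_transversal sigma act x0 act1 actM trans
              (free_relative_generates (free_Markov_relative _ _ _ hG)))
    as (r & r0 & actr & r_ind).
  eexists _, _, _.
  exact (schreier_free_relative hG hH act x0 act1 actM act_open stab r r0 actr r_ind).
Qed.

(** * From relative freeness to a Markov basis *)

(** Otherwise every clopen set containing [T] is all of [E]. Pulled back along [e => x * s e], each
    piece of the separation is such a set when it contains [x]; so the pieces are stable under the
    generators, hence under [G]. *)
Lemma disconnected_clopen {E : TopSpace} {T : E -> Prop} {G : TopGroup} {s : E -> G}
    (hs : free_relative E T G s) :
  disconnected (fun _ : G => True) ->
  exists A : E -> Prop, is_open A /\ is_open (fun e => ~ A e) /\
    (forall e, T e -> A e) /\ exists b, ~ A b.
Proof.
  intros (U & V & HU & HV & (u & _ & Uu) & (v & _ & Vv) & cover & disj).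
  apply NNPP. intros N.
  assert (full : forall A : E -> Prop, is_open A -> is_open (fun e => ~ A e) ->
      (forall e, T e -> A e) -> forall e, A e).
  { intros A HA HA' TA e. apply NNPP. intros Ae. apply N. exists A. eauto. }
  pose proof hs as (Cs & sT & _).
  assert (tc : forall (x : G) (W : G -> Prop), is_open W -> is_open (fun e => W (mul x (s e)))).
  { intros x. apply continuous_mul; [apply continuous_const | exact Cs]. }
  assert (step : forall (P Q : G -> Prop), is_open P -> is_open Q ->
      (forall x, P x <-> ~ Q x) -> forall x e, P x -> P (mul x (s e))).
  { intros P Q HP HQ PQ x e Px. apply (full (fun e => P (mul x (s e)))).
    - exact (tc x P HP).
    - apply (open_ext (fun e => Q (mul x (s e)))); [|exact (tc x Q HQ)].
      intros e'. rewrite PQ. split; [tauto | apply NNPP].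
    - intros e' Te'. now rewrite sT, mulg1. }
  assert (UV : forall x, U x <-> ~ V x).
  { intros x. specialize (cover x I). specialize (disj x I). tauto. }
  assert (VU : forall x, V x <-> ~ U x).
  { intros x. specialize (cover x I). specialize (disj x I). tauto. }
  (* The equivalence for all [x] makes these [w] a subgroup; its reverse direction on generators is
     [step] applied to [V]. *)
  assert (all : forall w x, U x <-> U (mul x w)).
  { apply (free_relative_generates hs (fun w => forall x, U x <-> U (mul x w))).
    - split; [|split].
      + intros x. now rewrite mulg1.
      + intros a b Ha Hb x. now rewrite mulA, <- Hb.
      + intros a Ha x. now rewrite (Ha (mul x (inv a))), mulgKV.
    - intros e x. split; [apply (step U V); auto|].
      rewrite !UV. intros NV Vx. apply NV, (step V U); auto. }
  apply (disj v I); [|exact Vv].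
  rewrite <- (mul1g _ v), <- (mulgV u), <- mulA. now apply all.
Qed.

Section Collapse.
Context {E : TopSpace} (T : E -> Prop) (b : E).

(** [b] serves as the name of the point to which [T] and [b] are identified. *)
Definition collapse (e : E) : E := if excluded_middle_informative (T e) then b else e.

(** The quotient is encoded by chosen representatives, the image of [collapse], with the quotient
    topology. *)
Definition collapsed_space : TopSpace.
Proof.
  refine {| pt := {z | exists e, collapse e = z};
            is_open := fun U => is_open (fun e => U (exist _ (collapse e) (ex_intro _ e eq_refl))) |}.
  - apply open_full.
  - intros U V. apply open_inter.
  - intros F HF. apply open_local. intros e (U & FU & Ue).
    eexists. split; [exact (HF U FU)|]. split; [exact Ue|]. intros z Uz. exists U. auto.
Defined.

Definition collapse_proj (e : E) : collapsed_space :=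
  exist _ (collapse e) (ex_intro _ e eq_refl).

Lemma collapse_proj_surj (z : collapsed_space) : exists e, collapse_proj e = z.
Proof.
  destruct z as [z [e Ee]]. exists e. destruct Ee. reflexivity.
Qed.

Lemma collapse_proj_continuous : continuous collapse_proj.
Proof. intros U HU. exact HU. Qed.

End Collapse.

Section MarkovBasis.
Context {E : TopSpace} {T : E -> Prop} {G : TopGroup} {s : E -> G}.
Hypothesis hs : free_relative E T G s.
Variables (A : E -> Prop) (b : E).
Hypotheses (HA : is_open A) (HA' : is_open (fun e => ~ A e)).
Hypotheses (TA : forall e, T e -> A e) (Ab : ~ A b).

(** The twist by [s b] on [A] gives every point of [T] the value [s b], which is also the value at
    [b]; hence the map descends to the collapsed space. *)
Definition markov_gen (e : E) : G :=
  if excluded_middle_informative (A e) then mul (s e) (s b) else s e.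

Lemma markov_genA e : A e -> markov_gen e = mul (s e) (s b).
Proof. intros a. unfold markov_gen. now destruct excluded_middle_informative. Qed.

Lemma markov_genN e : ~ A e -> markov_gen e = s e.
Proof. intros a. unfold markov_gen. now destruct excluded_middle_informative. Qed.

Lemma collapse_T e : T e -> collapse T b e = b.
Proof. intros t. unfold collapse. now destruct excluded_middle_informative. Qed.

Lemma collapse_b : collapse T b b = b.
Proof. unfold collapse. now destruct excluded_middle_informative. Qed.

Lemma markov_gen_collapse e : markov_gen (collapse T b e) = markov_gen e.
Proof.
  unfold collapse. destruct excluded_middle_informative as [t|]; [|reflexivity].
  rewrite (markov_genN b Ab), (markov_genA e (TA e t)).
  now rewrite (proj1 (proj2 hs) e t), mul1g.
Qed.

Definition markov_basis (z : collapsed_space T b) : G := markov_gen (proj1_sig z).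

Lemma markov_basis_proj e : markov_basis (collapse_proj T b e) = markov_gen e.
Proof. apply markov_gen_collapse. Qed.

Lemma markov_basis_free : is_free_Markov (collapsed_space T b) G markov_basis.
Proof.
  pose proof hs as (Cs & sT & U). split.
  - intros V HV. apply (open_ext (fun e => V (markov_gen e))).
    { intros e. change (exist _ _ _) with (collapse_proj T b e). now rewrite markov_basis_proj. }
    refine (continuous_clopen_cases A (fun e => mul (s e) (s b)) s markov_gen
              HA HA' _ Cs markov_genA markov_genN V HV).
    apply continuous_mul; [exact Cs | apply continuous_const].
  - intros K f Cf. pose (F := fun e => f (collapse_proj T b e)).
    (* Undoing the twist turns [F] into a map that is trivial on [T], where [F] has the constant
       value [F b]. *)
    pose (g := fun e => if excluded_middle_informative (A e) then mul (F e) (inv (F b)) else F e).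
    assert (gA : forall e, A e -> g e = mul (F e) (inv (F b))).
    { intros e a. unfold g. now destruct excluded_middle_informative. }
    assert (gN : forall e, ~ A e -> g e = F e).
    { intros e a. unfold g. now destruct excluded_middle_informative. }
    assert (CF : continuous F).
    { exact (continuous_comp _ _ (collapse_proj_continuous T b) Cf). }
    assert (FT : forall e, T e -> F e = F b).
    { intros e t. unfold F. f_equal. apply val_inj with (P := fun z => exists e, collapse T b e = z).
      simpl. now rewrite collapse_b, collapse_T. }
    destruct (U K g) as (h & (Hh & Ch & Eh) & Uh).
    { refine (continuous_clopen_cases A _ F g HA HA' _ CF gA gN).
      apply continuous_mul; [exact CF | apply continuous_const]. }
    { intros e t. rewrite gA by auto. rewrite FT by exact t. apply mulgV. }
    exists h. split.
    + split; [exact Hh|]. split; [exact Ch|]. intros z.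
      destruct (collapse_proj_surj T b z) as [e <-].
      rewrite markov_basis_proj. change (f _) with (F e).
      destruct (classic (A e)) as [a|a].
      * rewrite markov_genA, Hh, !Eh, gA, (gN b Ab) by exact a. apply mulgKV.
      * rewrite markov_genN, Eh, gN by exact a. reflexivity.
    + intros h' (Hh' & Ch' & Eh'). apply Uh. split; [exact Hh'|]. split; [exact Ch'|].
      (* Since [b] lies off [A], [h'] is determined at [s b], and the twist can then be removed on
         [A]. *)
      assert (EF : forall e, h' (markov_gen e) = F e).
      { intros e. rewrite <- markov_basis_proj. apply Eh'. }
      assert (hb : h' (s b) = F b).
      { now rewrite <- EF, (markov_genN b Ab). }
      intros e. destruct (classic (A e)) as [a|a].
      * rewrite gA, <- EF, markov_genA, Hh', hb by exact a. symmetry. apply mulgK.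
      * now rewrite gN, <- EF, markov_genN by exact a.
Qed.

End MarkovBasis.

(** * Transfer of disconnectedness and the equivalence *)

Lemma free_Markov_disconnected (Z : TopSpace) (F : TopGroup) (tau : Z -> F) :
  inhabited Z -> is_free_Markov Z F tau -> disconnected (fun _ : F => True).
Proof.
  intros [z] [_ U].
  (* The constant map at the nontrivial element extends to a hom whose fibres separate [tau z] from
     [one]. *)
  destruct (U Z2 (fun _ => true) (continuous_const _)) as (h & (Hh & Ch & Eh) & _).
  exists (fun x => h x = true), (fun x => h x = false).
  split; [exact (Ch (fun t => t = true) I)|].
  split; [exact (Ch (fun t => t = false) I)|].
  split; [exists (tau z); auto|].
  split; [exists one; split; [exact I | exact (hom_one h Hh)]|].
  split; [intros x _; destruct (h x : bool); auto|].
  intros x _ -> [=].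
Qed.

Lemma disconnected_image {F G : TopGroup} (phi : F -> G) (H : G -> Prop) :
  topgroup_iso_onto phi H -> disconnected (fun _ : F => True) -> disconnected H.
Proof.
  intros (_ & inj & img & _ & op) (U & V & HU & HV & (u & _ & Uu) & (v & _ & Vv) & cover & disj).
  destruct (op U HU) as (U' & HU' & EU), (op V HV) as (V' & HV' & EV).
  exists U', V'. split; [exact HU'|]. split; [exact HV'|].
  split; [exists (phi u); apply EU; eauto|].
  split; [exists (phi v); apply EV; eauto|]. split.
  - intros g Hg. apply img in Hg as [x <-].
    destruct (cover x I); [left; apply EU | right; apply EV]; eauto.
  - intros g Hg Ug Vg.
    destruct (proj2 (EU g) (conj Hg Ug)) as (x & Ux & Ex).
    destruct (proj2 (EV g) (conj Hg Vg)) as (y & Vy & Ey).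
    rewrite <- Ey in Ex. apply inj in Ex. subst y. exact (disj x I Ux Vy).
Qed.

Lemma disconnected_subgroup {G : TopGroup} (H : G -> Prop) (hH : subgroup H) :
  disconnected H -> disconnected (fun _ : subgroup_topgroup H hH => True).
Proof.
  intros (U & V & HU & HV & (u & Hu & Uu) & (v & Hv & Vv) & cover & disj).
  exists (fun x => U (proj1_sig x)), (fun x => V (proj1_sig x)).
  split; [exact (continuous_val H U HU)|]. split; [exact (continuous_val H V HV)|].
  split; [now exists (exist _ u Hu)|]. split; [now exists (exist _ v Hv)|].
  split; intros [x Hx] _; simpl; eauto.
Qed.

Lemma subgroup_iso_onto {G : TopGroup} (H : G -> Prop) (hH : subgroup H) :
  topgroup_iso_onto (fun x : subgroup_topgroup H hH => proj1_sig x) H.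
Proof.
  split; [now intros x y|]. split; [apply val_inj|]. split; [|split].
  - intros g. split; [intros Hg; now exists (exist _ g Hg)|].
    intros [[x Hx] <-]. exact Hx.
  - exact (continuous_val H).
  - intros U (V & HV & EV). exists V. split; [exact HV|]. intros g. split.
    + intros ([x Hx] & Ux & <-). split; [exact Hx | now apply EV in Ux].
    + intros [Hg Vg]. exists (exist _ g Hg). split; [now apply EV | reflexivity].
Qed.

(** [Z] is taken nonempty: over the empty space the free group is trivial, hence connected. *)
Theorem theorem4 (Y : TopSpace) (G : TopGroup) (sigma : Y -> G)
  (hG : is_free_Markov Y G sigma) (H : G -> Prop)
  (hH : subgroup H) (hHo : is_open H) :
  (exists (Z : TopSpace) (FZ : TopGroup) (tau : Z -> FZ) (phi : FZ -> G),
      inhabited (pt Z) /\ is_free_Markov Z FZ tau /\ topgroup_iso_onto phi H)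
  <-> disconnected H.
Proof.
  split.
  - intros (Z & FZ & tau & phi & i & free & iso).
    exact (disconnected_image phi H iso (free_Markov_disconnected Z FZ tau i free)).
  - intros D.
    destruct (open_subgroup_free_relative Y G sigma hG H hH hHo) as (E & T & s & hs).
    destruct (disconnected_clopen hs (disconnected_subgroup H hH D))
      as (A & HA & HA' & TA & b & Ab).
    exists (collapsed_space T b), (subgroup_topgroup H hH), (markov_basis (s := s) A b),
      (fun x => proj1_sig x).
    split; [exact (inhabits (collapse_proj T b b))|].
    split; [now apply markov_basis_free | apply subgroup_iso_onto].
Qed.
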